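(* Assume condition (C) below holds. Then for every $\boldsymbol\theta\in\boldsymbol\Theta$ and all $a,b>0$, the test $(\hat T,\hat D)$ satisfies $\mathrm P_{\boldsymbol\theta}(\hat T<\infty)=1$, $$\mathrm P_{\boldsymbol\theta}(\hat D\setminus A(\boldsymbol\theta)\ne\emptyset)\le 1/a,\qquad \mathrm P_{\boldsymbol\theta}(A(\boldsymbol\theta)\setminus\hat D\ne\emptyset)\le 1/b.$$ In particular, $(\hat T,\hat D)\in\Delta(\alpha,\beta)$ when $a=1/\alpha$ and $b=1/\beta$, for any $\alpha,\beta\in(0,1)$.
   Context: Setting: $K\ge1$ mutually independent data streams $\{X_k(n),n\ge1\}$, $k\in[K]$, each i.i.d. with density $f_{\theta_k}$ w.r.t. a $\sigma$-finite measure $\nu$, $\{f_\theta:\theta\in\Theta\}$ a parametric family, $\Theta=\Theta^0\cup\Theta^1$ with $\Theta^0,\Theta^1$ nonempty disjoint (noise/signal parameters). $I(\theta,\theta')=\int f_\theta\log(f_\theta/f_{\theta'})d\nu$; standing assumption $\inf_{\theta\in\Theta^1}I(\theta^0,\theta)>0$ for all $\theta^0\in\Theta^0$ and $\inf_{\theta\in\Theta^0}I(\theta^1,\theta)>0$ for all $\theta^1\in\Theta^1$. $\boldsymbol\Theta=\{\boldsymbol\theta\in\Theta^K:\exists\theta^0\in\Theta^0,\theta^1\in\Theta^1$ with $\theta_k=\theta^0$ whenever $\theta_k\in\Theta^0$ and $\theta_k=\theta^1$ whenever $\theta_k\in\Theta^1\}$. $\mathrm P_{\boldsymbol\theta}$: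 stream $k$ has density $f_{\theta_k}$. $I(\boldsymbol\theta,\boldsymbol\theta')=\sum_kI(\theta_k,\theta_k')$. $A(\boldsymbol\theta)=\{k:\theta_k\in\Theta^1\}$. $\mathcal F(n)=\sigma(X_k(t):t\le n,k\in[K])$; a test is $(T,D)$ with $T$ a stopping time and $D\subseteq[K]$ $\mathcal F(T)$-measurable; $\Delta(\alpha,\beta)$ = tests with, for all $\boldsymbol\theta\in\boldsymbol\Theta$, $\mathrm P_{\boldsymbol\theta}(T<\infty)=1$, $\mathrm P_{\boldsymbol\theta}(D\setminus A(\boldsymbol\theta)\neq\emptyset)\le\alpha$, $\mathrm P_{\boldsymbol\theta}(A(\boldsymbol\theta)\setminus D\ne\emptyset)\le\beta$. $I^0(\boldsymbol\theta)=\inf\{I(\boldsymbol\theta,\boldsymbol\theta'):\boldsymbol\theta'\in\boldsymbol\Theta, A(\boldsymbol\theta')\setminus A(\boldsymbol\theta)\ne\emptyset\}$, $I^1(\boldsymbol\theta)=\inf\{I(\boldsymbol\theta,\boldsymbol\theta'):\boldsymbol\theta'\in\boldsymbol\Theta, A(\boldsymbol\theta)\setminus A(\boldsymbol\theta')\ne\emptyset\}$, $\inf\emptyset=+\infty$. The procedure: $L_k(n;\theta)=\prod_{t=1}^nf_\theta(X_k(t))$; $\boldsymbol L(n;\boldsymbol\theta')=\prod_kL_k(n;\theta'_k)$; $L_k^i(n)=\sup_{\theta\in\Theta^i}L_k(n;\theta)$, $i=0,1$. $\hat\theta_k(n)\in\Theta$ is a (near-)MLE: $L_k(n;\hat\theta_k(n))\ge\sup_{\theta\in\Theta}L_k(n;\theta)-1/n$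 (an exact maximizer if it exists), $\hat\theta_k(0)\in\Theta$ arbitrary. Adaptive joint likelihood: $\hat{\boldsymbol L}(0)=1$, $\hat{\boldsymbol L}(n)=\hat{\boldsymbol L}(n-1)\prod_{k}f_{\hat\theta_k(n-1)}(X_k(n))$. $\hat A(n)=\{k:L_k^1(n)\ge L_k^0(n)\}$. $\boldsymbol L^0(n)=\sup\{\boldsymbol L(n;\boldsymbol\theta'):\boldsymbol\theta'\in\boldsymbol\Theta, A(\boldsymbol\theta')\setminus\hat A(n)\neq\emptyset\}$, $\boldsymbol L^1(n)=\sup\{\boldsymbol L(n;\boldsymbol\theta'):\boldsymbol\theta'\in\boldsymbol\Theta,\hat A(n)\setminus A(\boldsymbol\theta')\ne\emptyset\}$ (supremum of empty set is $0$, and $x/0=+\infty$ for $x>0$). For thresholds $a,b>0$: $\hat T=\inf\{n\ge1:\hat{\boldsymbol L}(n)/\boldsymbol L^0(n)\ge b\text{ and }\hat{\boldsymbol L}(n)/\boldsymbol L^1(n)\ge a\}$, $\hat D=\hat A(\hat T)$. Condition (C): for every $\boldsymbol\theta\in\boldsymbol\Theta$, $\epsilon>0$, $i\in\{0,1\}$: $\sum_{n\ge1}\mathrm P_{\boldsymbol\theta}\big(\tfrac1n\log\frac{\hat{\boldsymbol L}(n)}{\boldsymbol L^i(n)}\le I^i(\boldsymbol\theta)-\epsilon\big)<\infty$.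
   Formalization: Where I^i(θ)=+∞ (always so for i=1, A(θ)=∅), condition (C) read literally can never hold; it is taken as summability with every real c<I^i(θ) in place of I^i(θ)−ε. The final ''in particular'' (a=1/α, b=1/β; T̂ a stopping time) is not restated. *)

(* Defs.v *)
From mathcomp Require Import all_boot all_order all_algebra.
From mathcomp Require Import all_classical all_reals all_analysis.
From mathcomp Require Import measurable_realfun.
Import Order.TTheory GRing.Theory Num.Theory.
Set Implicit Arguments.
Unset Strict Implicit.
Local Open Scope classical_set_scope.
Local Open Scope ring_scope.

(* Conventions:
   - Th : the parameter set Theta (a measurable type), Th1 : set Th is the set
     Theta^1 of signal parameters, Theta^0 := ~` Th1 (noise parameters).
   - streams are indexed by k : 'I_K; observation X_k(t+1) of the paper is
     [X k t] (time is shifted by one, t = 0,1,2,...).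
   - P th is the probability P_theta on the sample space Om.               *)

Section Model.
Context (R : realType) (dS dT dO : measure_display)
  (S : measurableType dS) (Th : measurableType dT) (Om : measurableType dO)
  (K : nat).
Variables (nu : {measure set S -> \bar R}) (f : Th -> S -> R) (Th1 : set Th).

Definition Thi (i : bool) : set Th := if i then Th1 else ~` Th1.

(* supremum with the convention sup(empty) = 0 (all values are >= 0) *)
Definition sup0 (E : set (\bar R)) : \bar R := ereal_sup (E `|` [set 0%E]).

Definition density_family : Prop :=
  forall th, (forall x, 0 <= f th x) /\ measurable_fun setT (f th) /\
             (\int[nu]_x (f th x)%:E = 1)%E.

Definition kl (th th' : Th) : \bar R :=
  (\int[nu]_x (if f th x == 0%R then 0%E
               else if f th' x == 0%R then +oo%E
               else (f th x * ln (f th x / f th' x))%:E))%E.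

Definition klv (th th' : 'I_K -> Th) : \bar R :=
  (\sum_(k < K) kl (th k) (th' k))%E.

Definition standing_assumption : Prop :=
  (forall th0, ~ Th1 th0 -> (0 < ereal_inf [set kl th0 th | th in Th1])%E) /\
  (forall th1, Th1 th1 -> (0 < ereal_inf [set kl th1 th | th in ~` Th1])%E).

Definition Aset (th : 'I_K -> Th) : set 'I_K := [set k | Th1 (th k)].

Definition boldTheta : set ('I_K -> Th) :=
  [set th | exists th0 th1, ~ Th1 th0 /\ Th1 th1 /\
     forall k, (Th1 (th k) -> th k = th1) /\ (~ Th1 (th k) -> th k = th0)].

(* I^0 (i = false) and I^1 (i = true); ereal_inf set0 = +oo *)
Definition Ibold (i : bool) (th : 'I_K -> Th) : \bar R :=
  ereal_inf [set klv th th' | th' in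
    [set th' | boldTheta th' /\
       (if i then Aset th `\` Aset th' else Aset th' `\` Aset th) != set0]].

Variables (X : 'I_K -> nat -> Om -> S) (P : ('I_K -> Th) -> probability Om R).

Definition indep_streams (Q : probability Om R) : Prop :=
  forall (s : seq ('I_K * nat)) (B : 'I_K * nat -> set S),
    uniq s -> (forall j, measurable (B j)) ->
    Q (\big[setI/setT]_(j <- s) (X j.1 j.2 @^-1` B j)) =
    (\prod_(j <- s) Q (X j.1 j.2 @^-1` B j))%E.

Definition has_law (th : 'I_K -> Th) : Prop :=
  indep_streams (P th) /\
  forall k t B, measurable B ->
    P th (X k t @^-1` B) = (\int[nu]_(x in B) (f (th k) x)%:E)%E.

Definition Lk (k : 'I_K) (n : nat) (th : Th) (w : Om) : R :=
  \prod_(t < n) f th (X k t w).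

Definition Lv (n : nat) (th : 'I_K -> Th) (w : Om) : R :=
  \prod_(k < K) Lk k n (th k) w.

Definition Lsup (i : bool) (k : 'I_K) (n : nat) (w : Om) : \bar R :=
  sup0 [set (Lk k n th w)%:E | th in Thi i].

Definition data (k : 'I_K) (n : nat) (w : Om) : n.-tuple S :=
  [tuple X k (nat_of_ord t) w | t < n].

Variable thhat : 'I_K -> forall n : nat, n.-tuple S -> Th.

Definition nearMLE : Prop :=
  forall k n w, (0 < n)%N ->
    let L := fun th => (Lk k n th w)%:E in
    let s := ereal_sup [set L th | th in [set: Th]] in
    let th_n := @thhat k n (data k n w) in
    (s - (n%:R^-1)%:E <= L th_n)%E /\ ((exists th, L th = s) -> L th_n = s).

Definition Lhat (n : nat) (w : Om) : R :=
  \prod_(t < n) \prod_(k < K) f (@thhat k t (data k t w)) (X k t w).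

Definition Ahat (n : nat) (w : Om) : set 'I_K :=
  [set k | (Lsup false k n w <= Lsup true k n w)%E].

Definition Lbig (i : bool) (n : nat) (w : Om) : \bar R :=
  sup0 [set (Lv n th w)%:E | th in
    [set th | boldTheta th /\
       (if i then Ahat n w `\` Aset th else Aset th `\` Ahat n w) != set0]].

Definition elog (x : \bar R) : \bar R :=
  match x with
  | r%:E => if r <= 0 then -oo%E else (ln r)%:E
  | +oo%E => +oo%E
  | -oo%E => -oo%E
  end.

(* Condition (C); the event is {(1/n) log(hat L(n)/L^i(n)) <= c} for every
   real c < I^i(theta) (c = I^i(theta) - eps when I^i(theta) is finite).
   Division in \bar R: x / 0 = +oo for x > 0, x / +oo = 0. *)
Definition condC : Prop :=
  forall th, boldTheta th -> forall (i : bool) (c : R), (c%:E < Ibold i th)%E ->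
    (\sum_(1 <= n <oo)
       P th [set w | ((n%:R^-1)%:E * elog ((Lhat n w)%:E / Lbig i n w)
                       <= c%:E)%E] < +oo)%E.

(* regularity (implicit in the paper): the statistics are random variables *)
Definition stats_measurable : Prop :=
  forall n, (forall i k, measurable_fun [set: Om] (Lsup i k n : Om -> \bar R)) /\
            (forall i, measurable_fun [set: Om] (Lbig i n : Om -> \bar R)).

Definition stopcond (a b : R) (n : nat) (w : Om) : Prop :=
  (b%:E <= (Lhat n w)%:E / Lbig false n w)%E /\
  (a%:E <= (Lhat n w)%:E / Lbig true n w)%E.

Definition That_eq (a b : R) (n : nat) (w : Om) : Prop :=
  (0 < n)%N /\ stopcond a b n w /\
  forall m, (0 < m)%N -> (m < n)%N -> ~ stopcond a b m w.

End Model.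

(* Main.v *)
(* By Gibbs' inequality and the standing assumption I^0(theta) and I^1(theta)
   are positive, so under condition (C) both ratios hat L(n) / L^i(n) exceed any
   fixed threshold with probability tending to one: the procedure stops.  When
   it makes an error of the first kind, theta itself competes in the supremum
   L^1(T), hence hat L(T) / L(T; theta) >= a.  As the estimators plugged into
   hat L only use past data, hat L / L(.; theta) is, under P_theta, a nonnegative
   supermartingale starting at one, and Ville's inequality bounds the
   probability of this event by 1/a.  Errors of the second kind are symmetric. *)
Require Import Defs.
From mathcomp Require Import all_boot all_order all_algebra.
From mathcomp Require Import all_classical all_reals all_analysis.
From mathcomp Require Import measurable_realfun.
Import Order.TTheory GRing.Theory Num.Theory.
Local Open Scope classical_set_scope.
Local Open Scope ring_scope.

Set Implicit Arguments.
Unset Strict Implicit.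

(** * Integrals under independence and under a density *)

Section independence.
Context (R : realType) (dO dS : measure_display) (Om : measurableType dO)
  (S : measurableType dS).
Variables (P : probability Om R) (G : set (set Om)) (Z : Om -> S).
Hypothesis mG : G `<=` measurable.
Hypothesis GT : G setT.
Hypothesis GI : setI_closed G.
Hypothesis mZ : measurable_fun setT Z.
Hypothesis indepGZ : forall A B, G A -> measurable B ->
  P (A `&` Z @^-1` B) = (P A * P (Z @^-1` B))%E.

(** Both sides are finite measures in [A] with the same total mass, and they agree on the pi-system
    [G]. *)
Lemma indep_sigma_algebra A B : <<s G >> A -> measurable B ->
  P (A `&` Z @^-1` B) = (P A * P (Z @^-1` B))%E.
Proof.
move=> sA mB.
have mZB : measurable (Z @^-1` B).
  by rewrite -[X in measurable X]setTI; exact: mZ.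
have fZB : P (Z @^-1` B) \is a fin_num by exact: fin_num_measure.
have rge0 : 0 <= fine (P (Z @^-1` B)) by exact: fine_ge0.
pose m1 : {measure set Om -> \bar R} := mrestr P mZB.
pose m2 : {measure set Om -> \bar R} := mscale (NngNum rge0) P.
have m1E C : m1 C = P (C `&` Z @^-1` B) by [].
have m2E C : m2 C = (P C * P (Z @^-1` B))%E.
  by rewrite /m2/= /mscale/= fineK// muleC.
rewrite -m1E -m2E.
apply: (g_sigma_algebra_measure_unique G mG (fun=> setT)) => //.
- by rewrite bigcup_const.
- by move=> C GC; rewrite m1E m2E indepGZ.
- by move=> _; rewrite m1E setTI -ge0_fin_numE.
Qed.

(** The sample space with its sigma-algebra coarsened to the one generated by [G]; measurability on
    [OG] means being determined by that information. *)
Let OG : measurableType G.-sigma := g_sigma_algebraType G.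

Lemma measurable_id_sigma : measurable_fun (setT : set Om) (id : Om -> OG).
Proof.
move=> _ A mA; rewrite setTI.
by have := smallest_sub (@sigma_algebra_measurable _ Om) mG mA.
Qed.

(** By independence the joint law of [w], seen in [OG], and [Z w] is the product of the marginals,
    and Tonelli's theorem integrates out [Z] with [w] held fixed. *)
Lemma integral_indep (h : OG * S -> \bar R) :
  measurable_fun setT h -> (forall z, 0 <= h z)%E ->
  (\int[P]_w h (w, Z w) = \int[P]_w \int[pushforward P Z]_x h (w, x))%E.
Proof.
move=> mh h0.
pose idG : {mfun Om >-> OG} := mfun_Sub (mem_set measurable_id_sigma).
pose Zm : {mfun Om >-> S} := mfun_Sub (mem_set mZ).
have mp : measurable_fun setT (fun w : Om => (w : OG, Z w)).
  by apply/measurable_fun_pair => //; exact: measurable_id_sigma.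
pose pm : {mfun Om >-> (OG * S)%type} := mfun_Sub (mem_set mp).
have prodE A : measurable A ->
    (distribution P idG \x distribution P Zm)%E A = distribution P pm A.
  apply: product_measure_unique => B C mB mC.
  exact: indep_sigma_algebra.
transitivity (\int[distribution P pm]_z h z)%E.
  by rewrite ge0_integral_distribution.
transitivity (\int[distribution P idG \x distribution P Zm]_z h z)%E.
  by apply: eq_measure_integral => A mA _; exact: esym (prodE A mA).
rewrite fubini_tonelli1//.
rewrite ge0_integral_distribution//.
  exact: measurable_fun_fubini_tonelli_F.
by move=> w; apply: integral_ge0.
Qed.

End independence.

Section density.
Local Open Scope ereal_scope.
Context (R : realType) (d : measure_display) (S : measurableType d).
Variables (nu mu : {measure set S -> \bar R}) (p : S -> R).
Hypotheses (p0 : forall x, (0 <= p x)%R) (mp : measurable_fun setT p).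
Hypothesis muE : forall B, measurable B -> mu B = \int[nu]_(x in B) (p x)%:E.

Import HBNNSimple.

(** The identity holds for indicators by [muE], for simple functions by linearity, and in general by
    monotone convergence along [nnsfun_approx]. *)
Lemma ge0_integral_density (h : S -> \bar R) :
  measurable_fun setT h -> (forall x, 0 <= h x) ->
  \int[mu]_x h x = \int[nu]_x (h x * (p x)%:E).
Proof.
move=> mh h0.
pose g := nnsfun_approx measurableT mh.
have gcvg x : EFin \o g ^~ x @ \oo --> h x by exact: cvg_nnsfun_approx.
have mgp n : measurable_fun setT (fun x => (g n x)%:E * (p x)%:E).
  by apply: emeasurable_funM; exact/measurable_EFinP.
have sfunE (s : {nnsfun S >-> R}) :
    \int[mu]_x (s x)%:E = \int[nu]_x ((s x)%:E * (p x)%:E).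
  under eq_integral do rewrite fimfunE -fsumEFin//.
  rewrite ge0_integral_fsum//; last 2 first.
  - by move=> y; exact/measurable_EFinP/measurable_funM.
  - by move=> y x _; rewrite nnfun_muleindic_ge0.
  under [RHS]eq_integral.
    move=> x _; rewrite fimfunE -fsumEFin// ge0_mule_fsuml; last first.
      by move=> y; rewrite EFinM nnfun_muleindic_ge0.
    over.
  rewrite /= ge0_integral_fsum//; last 2 first.
  - move=> y; apply: emeasurable_funM; last exact/measurable_EFinP.
    exact/measurable_EFinP/measurable_funM.
  - by move=> y x _; rewrite mule_ge0 ?lee_fin//
      -lee_fin EFinM nnfun_muleindic_ge0.
  apply: eq_fsbigr => r /[!inE] -[x0 _ r0].
  have rge0 : (0 <= r)%R by rewrite -r0.
  have ms : measurable (s @^-1` [set r]) by exact: measurable_sfunP.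
  under eq_integral do rewrite EFinM.
  rewrite ge0_integralZl//=; last exact/measurable_EFinP.
  rewrite integral_indic// setIT muE// integral_mkcond.
  under [RHS]eq_integral do rewrite EFinM -muleA.
  rewrite ge0_integralZl//=.
  - congr (_ * _); apply: eq_integral => x _.
    by rewrite epatch_indic /= muleC.
  - by apply: emeasurable_funM; exact/measurable_EFinP.
  - by move=> x _; rewrite mule_ge0 ?lee_fin.
transitivity (limn (fun n => \int[mu]_x (g n x)%:E)).
  rewrite -monotone_convergence//.
  - by apply: eq_integral => x _; apply/esym/cvg_lim => //; exact: gcvg.
  - by move=> n; exact/measurable_EFinP.
  - by move=> n x _; rewrite lee_fin.
  - by move=> x _ m n mn; rewrite lee_fin; exact/lefP/nd_nnsfun_approx.
rewrite (_ : (fun n => _) =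
    (fun n => \int[nu]_x ((g n x)%:E * (p x)%:E))); last first.
  by apply/funext => n; rewrite sfunE.
rewrite -monotone_convergence//.
- apply: eq_integral => x _; apply/cvg_lim => //.
  apply: cvgeZr => //; exact: gcvg.
- by move=> n x _; rewrite mule_ge0 ?lee_fin.
- move=> x _ m n mn; rewrite lee_wpmul2r ?lee_fin//.
  exact/lefP/nd_nnsfun_approx.
Qed.

End density.

(** * Ville's inequality *)

Section ville.
Local Open Scope ereal_scope.
Context (R : realType) (d : measure_display) (T : measurableType d).
Variables (P : probability T R) (M : nat -> T -> R) (a : R).
Hypothesis a0 : (0 < a)%R.
Hypothesis M0 : forall n w, (0 <= M n w)%R.
Hypothesis mM : forall n, measurable_fun setT (M n).

Let below n : set T := [set w | forall i, (i <= n)%N -> (M i w < a)%R].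

Hypothesis M_start : \int[P]_w (M 0 w)%:E <= 1.
(** The supermartingale inequality is asked only on the events of no crossing so far, where optional
    stopping uses it. *)
Hypothesis M_step : forall n,
  \int[P]_(w in below n) (M n.+1 w)%:E <= \int[P]_(w in below n) (M n w)%:E.

Let lt_measurable n : measurable [set w | (M n w < a)%R].
Proof.
rewrite -[X in measurable X]setTI -preimage_itvNyo.
by apply: mM => //; exact: measurable_itv.
Qed.

Let belowS n : below n.+1 = below n `&` [set w | (M n.+1 w < a)%R].
Proof.
apply/seteqP; split=> w /=.
  by move=> H; split=> [i ilen|]; apply: H => //; exact: leqW.
move=> [H Mn] i; rewrite leq_eqVlt => /orP[/eqP->//|].
by rewrite ltnS; exact: H.
Qed.

Let measurable_below n : measurable (below n).
Proof.
elim: n => [|n ih]; last by rewrite belowS; apply: measurableI.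
rewrite (_ : below 0 = [set w | (M 0 w < a)%R])//.
apply/seteqP; split=> w /=; first exact.
by move=> H i; rewrite leqn0 => /eqP->.
Qed.

Let mEM n D : measurable_fun D (EFin \o M n).
Proof. by apply: measurable_funTS; exact/measurable_EFinP. Qed.

Let markov D n : measurable D -> (forall w, D w -> (a <= M n w)%R) ->
  a%:E * P D <= \int[P]_(w in D) (M n w)%:E.
Proof.
move=> mD DM; rewrite -integral_cst//; apply: ge0_le_integral => //.
- by move=> w _; rewrite lee_fin ltW.
- exact: mEM.
Qed.

(* Optional stopping at the first crossing of [a], truncated at [n]. *)
Let stopped n :
  a%:E * P (~` below n) + \int[P]_(w in below n) (M n w)%:E <= 1.
Proof.
elim: n => [|n ih].
  apply: le_trans M_start.
  rewrite -(setUv (below 0)) ge0_integral_setU//=; last 4 first.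
  - exact: measurableC.
  - exact: mEM.
  - by move=> w _; rewrite lee_fin.
  - by apply/disj_setPS => w [].
  rewrite addeC leeD2l// markov//; first exact: measurableC.
  move=> w /= nb; rewrite leNgt; apply/negP => Mw; apply: nb => i.
  by rewrite leqn0 => /eqP->.
apply: le_trans ih.
(* This set is a first crossing exactly at time [n.+1]. Its mass moves from the integral to the
   probability term, and Markov's inequality pays for it with the integral of [M n.+1]. *)
have mC : measurable (below n `\` [set w | (M n.+1 w < a)%R]).
  exact: measurableD.
have -> : ~` below n.+1 =
    ~` below n `|` (below n `\` [set w | (M n.+1 w < a)%R]).
  rewrite belowS setCI; apply/seteqP; split=> w /=; last first.
    by case=> [|[]]; [left|right].
  case=> [|Mw]; first by left.
  by have [bw|bw] := pselect (below n w); [right|left].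
rewrite measureU//; last 2 first.
- exact: measurableC.
- by apply/seteqP; split=> w // [nb [bw _]]; exact: nb.
rewrite ge0_muleDr// -addeA leeD2l//.
apply: le_trans (M_step n).
rewrite [in leRHS](_ : below n =
    (below n `\` [set w | (M n.+1 w < a)%R]) `|` below n.+1); last first.
  by rewrite belowS setUC setUIDK.
rewrite ge0_integral_setU//=.
- rewrite leeD2r// markov// => w [_ /= Mw].
  by rewrite leNgt; apply/negP.
- exact: mEM.
- by move=> w _; rewrite lee_fin.
- by apply/disj_setPS => w [[_ Mw]]; rewrite belowS => -[].
Qed.

(** The events of a crossing by time [n] increase to the event of ever crossing. Each satisfies the
    bound by [stopped], once the nonnegative integral there is dropped, and continuity from below
    concludes. *)
Lemma ville_inequality : P [set w | exists n, (a <= M n w)%R] <= a^-1%:E.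
Proof.
have -> : [set w | exists n, (a <= M n w)%R] = \bigcup_n ~` below n.
  apply/seteqP; split=> w /=.
    by move=> [n an]; exists n => //= /(_ n (leqnn n)); rewrite ltNge an.
  move=> [n _ /= nb]; apply: contrapT => H; apply: nb => i _.
  by rewrite ltNge; apply/negP => ai; apply: H; exists i.
have mC n : measurable (~` below n) by exact: measurableC.
have nd : {homo (fun n => ~` below n) : m n / (m <= n)%N >-> (m <= n)%O}.
  move=> m n mn; apply/subsetPset => w /= nb b; apply: nb => i im.
  by apply: b; exact: leq_trans mn.
have cvgP := @nondecreasing_cvg_mu _ _ _ P _ mC (bigcupT_measurable _ mC) nd.
rewrite -(cvg_lim _ cvgP)//; apply: lime_le => /=.
  by apply/cvg_ex; eexists; exact: cvgP.
apply: nearW => n; rewrite -[leRHS]mul1e lee_pdivlMr// muleC.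
apply: le_trans (stopped n); rewrite leeDl//; apply: integral_ge0 => w _.
by rewrite lee_fin.
Qed.

End ville.

(** * Sequential likelihood ratios *)

(** On nonnegative reals inversion coincides with the power [-1], also at 0, where both give 0. *)
Lemma measurable_inv_ge0 (R : realType) (d : measure_display)
    (T : measurableType d) (g : T -> R) :
  (forall x, 0 <= g x) -> measurable_fun setT g ->
  measurable_fun setT (fun x => (g x)^-1).
Proof.
move=> g0 mg.
rewrite (_ : (fun x => _) = (fun r : R => r `^ (-1)) \o g).
  exact: measurableT_comp.
by apply/funext => x /=; rewrite powR_inv1.
Qed.

Section likelihood_ratio.
Context (R : realType) (dO dS : measure_display) (Om : measurableType dO)
  (S : measurableType dS).
Variables (P : probability Om R) (nu : {measure set S -> \bar R}).
Variables (Z : nat -> Om -> S) (p : nat -> S -> R) (q : nat -> Om -> S -> R).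

(** Finite-dimensional rectangles: a pi-system generating the information in the first [n]
    observations. *)
Definition cylinders (n : nat) : set (set Om) :=
  [set A | exists2 B : nat -> set S, (forall i, measurable (B i)) &
    A = [set w | forall i, (i < n)%N -> B i (Z i w)]].

Definition history (n : nat) : measurableType (cylinders n).-sigma :=
  g_sigma_algebraType (cylinders n).

Hypothesis mZ : forall i, measurable_fun setT (Z i).

Lemma cylinders_measurable n : cylinders n `<=` measurable.
Proof.
move=> _ [B mB ->].
rewrite (_ : [set w | _] = \bigcap_(i in [set i | (i < n)%N]) Z i @^-1` B i)//.
apply: bigcap_measurableType => i _.
by rewrite -[X in measurable X]setTI; exact: mZ.
Qed.

Lemma cylindersT n : cylinders n setT.
Proof. by exists (fun=> setT) => //; apply/seteqP; split. Qed.

Lemma cylindersI n : setI_closed (cylinders n).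
Proof.
move=> _ _ [B mB ->] [C mC ->]; exists (fun i => B i `&` C i).
  by move=> i; exact: measurableI.
apply/seteqP; split=> w /= => [[BZ CZ] i ilen|H].
  by split; [exact: BZ|exact: CZ].
by split=> i /H[].
Qed.

Lemma cylinders_preimage n i B : (i < n)%N -> measurable B ->
  cylinders n (Z i @^-1` B).
Proof.
move=> ilen mB; exists (fun j => if j == i then B else setT).
  by move=> j; case: ifP.
apply/seteqP; split=> w /= => [Bi j _|/(_ i ilen)]; last by rewrite eqxx.
by case: eqP => // ->.
Qed.

Lemma cylinders_mono m n : (m <= n)%N -> cylinders m `<=` cylinders n.
Proof.
move=> mn _ [B mB ->]; exists (fun i => if (i < m)%N then B i else setT).
  by move=> i; case: ifP.
apply/seteqP; split=> w /= H i im; first by case: ifPn => // /H.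
by have := H i (leq_trans im mn); rewrite im.
Qed.

Lemma measurable_history_obs n i : (i < n)%N ->
  measurable_fun setT (Z i : history n -> S).
Proof.
move=> ilen _ B mB; rewrite setTI.
by apply: sub_sigma_algebra; exact: cylinders_preimage.
Qed.

Lemma measurable_history_mono m n : (m <= n)%N ->
  measurable_fun setT (id : history n -> history m).
Proof.
move=> mn _ A mA; rewrite setTI.
by have := sub_sigma_algebra2 (D := setT) (cylinders_mono mn) mA.
Qed.

Lemma measurable_history d (T : measurableType d) n (g : Om -> T) :
  measurable_fun setT (g : history n -> T) -> measurable_fun setT g.
Proof.
move=> mg; apply: (measurableT_comp (f := g : history n -> T)) => //.
exact/measurable_id_sigma/cylinders_measurable.
Qed.

Hypothesis indepZ : forall n A B, cylinders n A -> measurable B ->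
  P (A `&` Z n @^-1` B) = (P A * P (Z n @^-1` B))%E.
Hypothesis p0 : forall n x, 0 <= p n x.
Hypothesis mp : forall n, measurable_fun setT (p n).
Hypothesis lawZ : forall n B, measurable B ->
  P (Z n @^-1` B) = (\int[nu]_(x in B) (p n x)%:E)%E.
Hypothesis q0 : forall n w x, 0 <= q n w x.
(** Predictability: as a function of the outcome, the plug-in density [q n] depends only on the
    observations of index below [n]. *)
Hypothesis mq : forall n,
  measurable_fun setT (fun z : history n * S => q n z.1 z.2).
Hypothesis q1 : forall n w, (\int[nu]_x (q n w x)%:E <= 1)%E.

(** Since [x / 0 = 0], a factor vanishes wherever [p i] does. This preserves the supermartingale
    inequality, but outcomes with a vanishing denominator have to be handled separately. *)
Definition likelihood_ratio (n : nat) (w : Om) : R :=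
  \prod_(i < n) (q i w (Z i w) / p i (Z i w)).

Lemma likelihood_ratio_ge0 n w : 0 <= likelihood_ratio n w.
Proof. by apply: prodr_ge0 => i _; rewrite divr_ge0. Qed.

Lemma measurable_likelihood_ratio n :
  measurable_fun setT (likelihood_ratio n : history n -> R).
Proof.
apply: measurable_prod => i _.
have mZi := measurable_history_obs (ltn_ord i).
have mWZ : measurable_fun setT (fun w : history n => (w : history i, Z i w)).
  apply/measurable_fun_pair => //.
  exact: (measurable_history_mono (ltnW (ltn_ord i))).
apply: measurable_funM; first exact: (measurableT_comp (@mq i) mWZ).
apply: measurable_inv_ge0 => //.
exact: measurableT_comp (@mp i) mZi.
Qed.

(* Given the history, the new factor has conditional expectation
   [\int q / p * p = \int_(p > 0) q <= 1]. *)
Lemma likelihood_ratio_step n (N : Om -> R) : (forall w, 0 <= N w) ->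
  measurable_fun setT (N : history n -> R) ->
  (\int[P]_w (N w * (q n w (Z n w) / p n (Z n w)))%:E <= \int[P]_w (N w)%:E)%E.
Proof.
move=> N0 mN.
pose h (z : history n * S) := (N z.1 * (q n z.1 z.2 / p n z.2))%:E.
have mh : measurable_fun setT h.
  apply/measurable_EFinP; apply: measurable_funM; first exact: measurableT_comp.
  apply: measurable_funM => //; apply: measurable_inv_ge0 => //.
  exact: measurableT_comp.
have h0 z : (0 <= h z)%E by rewrite lee_fin mulr_ge0// divr_ge0.
rewrite (integral_indep (cylinders_measurable (n := n)) (cylindersT n)
  (@cylindersI n) (@mZ n) (@indepZ n) mh h0).
pose Zn : {mfun Om >-> S} := mfun_Sub (mem_set (@mZ n)).
have mhw w : measurable_fun setT (fun x => h (w, x)).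
  by apply: measurableT_comp => //; exact: measurable_pair1.
have mqw w : measurable_fun setT (q n w).
  exact: (measurableT_comp (@mq n) (measurable_pair1 (w : history n))).
apply: ge0_le_integral => //.
- by move=> w _; apply: integral_ge0.
- have mF := measurable_fun_fubini_tonelli_F
    (m2 := distribution P Zn) h mh h0.
  by have := measurable_history mF.
- by apply/measurable_EFinP; have := measurable_history mN.
move=> w _.
rewrite (ge0_integral_density (nu := nu) (mu := distribution P Zn)
  (@p0 n) (@mp n) (lawZ n) (mhw w))//.
apply: (@le_trans _ _ (\int[nu]_x ((N w)%:E * (q n w x)%:E))%E).
  apply: ge0_le_integral => //.
  - by move=> x _; rewrite mule_ge0// lee_fin.
  - by apply: emeasurable_funM => //; exact/measurable_EFinP.
  - by apply: emeasurable_funM => //; exact/measurable_EFinP.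
  move=> x _; rewrite /h/= -!EFinM lee_fin -mulrA ler_wpM2l//.
  have [->|pn0] := eqVneq (p n x) 0; first by rewrite mulr0.
  by rewrite divfK.
rewrite ge0_integralZl//; last 3 first.
- exact/measurable_EFinP.
- by move=> x _; rewrite lee_fin.
- by rewrite lee_fin.
by rewrite -[leRHS]mule1 lee_wpmul2l ?lee_fin.
Qed.

Lemma likelihood_ratio_ville (a : R) : 0 < a ->
  (P [set w | exists n, (a <= likelihood_ratio n w)%R] <= (a^-1)%:E)%E.
Proof.
move=> a0; apply: ville_inequality => //.
- exact: likelihood_ratio_ge0.
- by move=> n; apply: measurable_history; exact: measurable_likelihood_ratio.
- under eq_integral do rewrite /likelihood_ratio big_ord0.
  by rewrite integral_cst// mul1e; exact: probability_le1.
move=> n.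
(* The event of no crossing up to [n] belongs to the history at time [n], so its indicator can be
   absorbed into the past factor [N]. *)
set D := [set w | _].
have mD : measurable (D : set (history n)).
  rewrite (_ : D = \bigcap_(i in [set i | (i <= n)%N])
      (likelihood_ratio i @^-1` [set` `]-oo, a[])); last first.
    by apply/seteqP; split=> w H i /H/=; rewrite in_itv.
  apply: bigcap_measurableType => i /= ilen.
  rewrite -[X in measurable X]setTI.
  have mLi := measurableT_comp (@measurable_likelihood_ratio i)
    (measurable_history_mono ilen).
  exact: (mLi measurableT _ (measurable_itv _)).
have mDO : measurable D.
  have := smallest_sub (@sigma_algebra_measurable _ Om)
    (cylinders_measurable (n := n)); exact.
rewrite integral_mkcond [leRHS]integral_mkcond.
pose N w := likelihood_ratio n w * \1_D w.
have -> : (\int[P]_w ((fun w => (likelihood_ratio n w)%:E) \_ D) w =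
    \int[P]_w (N w)%:E)%E.
  by apply: eq_integral => w _; rewrite epatch_indic.
have -> : (\int[P]_w ((fun w => (likelihood_ratio n.+1 w)%:E) \_ D) w =
    \int[P]_w (N w * (q n w (Z n w) / p n (Z n w)))%:E)%E.
  apply: eq_integral => w _; rewrite epatch_indic /= -EFinM.
  by rewrite /likelihood_ratio big_ord_recr/= mulrAC.
apply: likelihood_ratio_step => [w|].
  by rewrite mulr_ge0// likelihood_ratio_ge0.
by apply: measurable_funM; first exact: measurable_likelihood_ratio.
Qed.

End likelihood_ratio.

(** * Positivity of the information numbers *)

Section information.
Context (R : realType) (dS dT : measure_display) (S : measurableType dS)
  (Th : measurableType dT) (K : nat).
Variables (nu : {measure set S -> \bar R}) (f : Th -> S -> R) (Th1 : set Th).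
Hypothesis df : density_family nu f.

(** This is [ln y <= y - 1] at [y = v / u], multiplied by [u] and negated. *)
Lemma mul_ln_div_ge (u v : R) : 0 < u -> 0 < v -> u - v <= u * ln (u / v).
Proof.
move=> u0 v0.
have lnvu : ln (v / u) <= v / u - 1.
  have := @le_ln1Dx R (v / u - 1); rewrite (addrC 1) subrK; apply.
  by rewrite ltrBrDr addNr divr_gt0.
rewrite -[u / v]invf_div lnV ?posrE ?divr_gt0// mulrN lerNr opprB.
apply: le_trans (ler_wpM2l (ltW u0) lnvu) _.
by rewrite mulrBr mulr1 mulrCA divff ?gt_eqF// mulr1.
Qed.

Lemma integrable_density th : nu.-integrable setT (EFin \o f th).
Proof.
have [f0 [mf f1]] := df th.
apply/integrableP; split; first exact/measurable_EFinP.
under eq_integral do rewrite /= ger0_norm//.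
by rewrite f1 ltry.
Qed.

Local Open Scope ereal_scope.

(** Gibbs' inequality: the integrand dominates the difference of the two densities, whose integral
    is [1 - 1 = 0]. *)
Lemma kl_ge0 th th' : 0 <= kl nu f th th'.
Proof.
have [u0 [mu u1]] := df th.
have [v0 [mv v1]] := df th'.
pose d x : \bar R := (f th x)%:E - (f th' x)%:E.
have md : measurable_fun setT d.
  by apply: emeasurable_funB; exact/measurable_EFinP.
have int_d : \int[nu]_x d x = 0.
  rewrite integralB_EFin//; [|exact: integrable_density..].
  by rewrite u1 v1 subee.
have dneg_fin : \int[nu]_x d^\- x \is a fin_num.
  apply: integrable_neg_fin_num => //.
  by apply: integrableB => //; exact: integrable_density.
rewrite /kl; set g := fun x => _.
have dg x : d x <= g x.
  rewrite /d /g; case: eqP => [->|/eqP fu].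
    by rewrite sub0e leeNl oppe0 lee_fin.
  case: eqP => [->|/eqP fv]; first by rewrite leey.
  by rewrite -EFinB lee_fin mul_ln_div_ge// lt0r ?fu ?fv ?u0 ?v0.
have mg : measurable_fun setT g.
  apply: measurable_fun_ifT => //; first exact: measurable_fun_eqr.
  apply: measurable_fun_ifT => //; first exact: measurable_fun_eqr.
  apply/measurable_EFinP; apply: measurable_funM => //.
  apply: measurableT_comp => //.
  by apply: measurable_funM => //; exact: measurable_inv_ge0.
(* The integrand [g] may fail to be integrable, so the parts are compared separately: [d <= g] gives
   [g] the larger positive and the smaller negative part. *)
rewrite -int_d (integralE _ _ d) (integralE _ _ g); apply: leeB.
- apply: ge0_le_integral => //; [exact: measurable_funepos..|].
  move=> x _.
  by apply: (@funepos_le _ _ setT d g) => [y _|]; [exact: dg|rewrite inE].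
- apply: ge0_le_integral => //; [exact: measurable_funeneg..|].
  move=> x _.
  by apply: (@funeneg_le _ _ setT d g) => [y _|]; [exact: dg|rewrite inE].
Qed.

Lemma klv_ge (th th' : 'I_K -> Th) k :
  kl nu f (th k) (th' k) <= klv nu f th th'.
Proof.
rewrite /klv (bigD1 k)//= leeDl// sume_ge0// => i _; exact: kl_ge0.
Qed.

Hypothesis std : standing_assumption nu f Th1.

(** A competitor [th'] misclassifies some coordinate [k] in the direction set by [i], and that
    coordinate alone contributes at least the infimum in the standing assumption. Membership in
    [boldTheta] forces [th k] to be the one common signal or noise value, so this bound does not
    depend on [k]. *)
Lemma Ibold_gt0 i (th : 'I_K -> Th) : boldTheta Th1 th ->
  0 < Ibold nu f Th1 i th.
Proof.
have [std0 std1] := std.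
move=> [th0 [th1 [nth0 [Tth1 thE]]]]; case: i.
- apply: lt_le_trans (std1 _ Tth1) _.
  apply/ereal_infP => _ [th' [_ /set0P[k [/= /(thE k).1 thk nthk]]] <-].
  apply: le_trans (klv_ge th th' k).
  by apply: ereal_inf_lbound; rewrite thk; exists (th' k).
- apply: lt_le_trans (std0 _ nth0) _.
  apply/ereal_infP => _ [th' [_ /set0P[k [/= Tthk /(thE k).2 thk]]] <-].
  apply: le_trans (klv_ge th th' k).
  by apply: ereal_inf_lbound; rewrite thk; exists (th' k).
Qed.

End information.

(** * Ratios and series in the extended reals *)

Section extended_reals.
Local Open Scope ereal_scope.
Context (R : realType).

(** The conjunct [0 < l] settles the degenerate case [l = y = 0]: the quotient is then
    [0 * +oo = 0], below [c], although [c * y <= l] holds. *)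
Lemma le_ediv (c l : R) (y : \bar R) : (0 < c)%R -> (0 <= l)%R -> 0 <= y ->
  (c%:E <= l%:E / y) = ((0 < l)%R && (c%:E * y <= l%:E)).
Proof.
move=> c0 l0; case: y => [y|_|]; [|..|by rewrite leeNy_eq]; last first.
  by rewrite invey mule0 lee_fin leNgt c0/= gt0_muley ?lte_fin// leye_eq andbF.
rewrite lee_fin => y0; rewrite inver; case: eqVneq => [->|yn0].
  rewrite mule0 lee_fin l0 andbT; move: l0; rewrite le_eqVlt => /orP[/eqP<-|l0].
    by rewrite mul0e lee_fin leNgt c0 ltxx.
  by rewrite gt0_muley ?lte_fin// leey l0.
have {}y0 : (0 < y)%R by rewrite lt_neqAle eq_sym yn0.
rewrite -!EFinM !lee_fin ler_pdivlMr//; case: ltP => //= l0'.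
by apply/negbTE; rewrite -ltNge (le_lt_trans l0')// mulr_gt0.
Qed.

Lemma lt_ediv (c l : R) (y : \bar R) : (0 < c)%R -> (0 <= l)%R -> 0 <= y ->
  (c%:E < l%:E / y) = ((0 < l)%R && (c%:E * y < l%:E)).
Proof.
move=> c0 l0; case: y => [y|_|]; [|..|by rewrite leeNy_eq]; last first.
  rewrite invey mule0 lte_fin ltNge (ltW c0)/= gt0_muley ?lte_fin//.
  by rewrite [X in _ && X]ltNge leey andbF.
rewrite lee_fin => y0; rewrite inver; case: eqVneq => [->|yn0].
  rewrite mule0 lte_fin andbb; move: l0; rewrite le_eqVlt => /orP[/eqP<-|l0].
    by rewrite mul0e lte_fin ltNge (ltW c0) ltxx.
  by rewrite gt0_muley ?lte_fin// ltry l0.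
have {}y0 : (0 < y)%R by rewrite lt_neqAle eq_sym yn0.
rewrite -!EFinM !lte_fin ltr_pdivlMr//; case: (ltP 0%R l) => //= l0'.
by apply/negbTE; rewrite -leNgt (le_trans l0')// ltW// mulr_gt0.
Qed.

(** Removes the logarithm from the rate events, which become events about the ratio alone.
    Nonpositive [x], sent to [-oo] by [elog], satisfy both sides. *)
Lemma elog_le (n : nat) (x : \bar R) (c : R) : (0 < n)%N ->
  ((n%:R^-1)%:E * elog x <= c%:E) = (x <= (expR (n%:R * c))%:E).
Proof.
move=> n0; have ni0 : (0 < n%:R^-1 :> R)%R by rewrite invr_gt0 ltr0n.
case: x => [x||]; rewrite /elog.
- case: ifPn => [x0|]; first by rewrite gt0_muleNy ?lte_fin// leNye lee_fin
    (le_trans x0) ?expR_ge0.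
  rewrite -ltNge => x0; rewrite -EFinM !lee_fin mulrC ler_pdivrMr ?ltr0n//.
  by rewrite mulrC -ler_expR lnK.
- by rewrite gt0_muley ?lte_fin// !leye_eq.
- by rewrite gt0_muleNy ?lte_fin// !leNye.
Qed.

Lemma eventually_lbound_nneseries (u : (\bar R)^nat) (p : R) (m N : nat) :
  (forall n, 0 <= u n) -> (forall n, (N <= n)%N -> p%:E <= u n) ->
  \sum_(m <= n <oo) u n < +oo -> (p <= 0)%R.
Proof.
move=> u0 pu uoo; rewrite leNgt; apply/negP => p0.
have S0 : 0 <= \sum_(m <= n <oo) u n by exact: nneseries_ge0.
have Sfin : \sum_(m <= n <oo) u n \is a fin_num by rewrite ge0_fin_numE.
pose s := fine (\sum_(m <= n <oo) u n).
(* [k] is chosen with [k * p] above the whole sum, while the [k] terms starting at index [m + N]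
   already add up to at least [k * p]. *)
pose k := (Num.truncn (s / p)).+1.
have kp : (s < k%:R * p)%R.
  by rewrite -ltr_pdivrMr// /k truncnS_gt.
have : (k%:R * p)%:E <= s%:E.
  rewrite /s fineK//.
  apply: le_trans (@nneseries_lim_ge _ u xpredT m (m + N + k) _) => //.
  rewrite (big_cat_nat (n := (m + N)%N))/= ?leq_addr//.
  rewrite -[leLHS]add0e; apply: leeD; first exact: sume_ge0.
  elim: k {kp} => [|k ih]; first by rewrite mul0r addn0 big_geq.
  rewrite addnS big_nat_recr/= ?leq_addr// -natr1 mulrDl mul1r EFinD.
  apply: leeD => //; apply: pu.
  exact: leq_trans (leq_addl m N) (leq_addr k _).
by rewrite lee_fin leNgt kp.
Qed.

End extended_reals.

(** * The interleaved data streams *)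

Section streams.
Context (R : realType) (dS dT dO : measure_display)
  (S : measurableType dS) (Th : measurableType dT) (Om : measurableType dO)
  (K : nat).
Variables (nu : {measure set S -> \bar R}) (f : Th -> S -> R) (Th1 : set Th).
Variables (X : 'I_K -> nat -> Om -> S) (P : ('I_K -> Th) -> probability Om R).
Variable thhat : 'I_K -> forall n : nat, n.-tuple S -> Th.
Hypothesis K0 : (0 < K)%N.
Hypothesis df : density_family nu f.
Hypothesis mf : measurable_fun setT (fun p : Th * S => f p.1 p.2).
Hypothesis mX : forall k t, measurable_fun setT (X k t).
Hypothesis mthhat : forall k n, measurable_fun setT (@thhat k n).

(* The observations are revealed one at a time, as the single sequence
   [X_0(0), ..., X_(K-1)(0), X_0(1), ...]. *)
Let stream (m : nat) : 'I_K := Ordinal (ltn_pmod m K0).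
Let time (m : nat) : nat := (m %/ K)%N.
Let obs (m : nat) : Om -> S := X (stream m) (time m).
Let pos (j : 'I_K * nat) : nat := (j.2 * K + j.1)%N.

Let streamK k t : stream (pos (k, t)) = k.
Proof. by apply: val_inj; rewrite /= modnMDl modn_small. Qed.

Let timeK k t : time (pos (k, t)) = t.
Proof. by rewrite /time /pos /= divnMDl// divn_small// addn0. Qed.

Let posK m : pos (stream m, time m) = m.
Proof. by rewrite /pos /= -divn_eq. Qed.

Lemma prod_interleave (F : 'I_K -> nat -> R) n :
  \prod_(i < n * K) F (stream i) (time i) = \prod_(t < n) \prod_(k < K) F k t.
Proof.
elim: n => [|n ih]; first by rewrite !big_ord0.
rewrite big_ord_recr/= -ih mulSnr big_split_ord/=; congr (_ * _).
by apply: eq_bigr => k _; rewrite -[(n * K + k)%N]/(pos (k, n)) streamK timeK.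
Qed.

Let mobs m : measurable_fun setT (obs m).
Proof. exact: mX. Qed.

Let indep_obs th n A B : has_law nu f X P th -> cylinders obs n A ->
  measurable B ->
  P th (A `&` obs n @^-1` B) = (P th A * P th (obs n @^-1` B))%E.
Proof.
move=> [ind _] [C mC ->] mB.
pose e m := (stream m, time m).
have e_inj : injective e by move=> i j /(congr1 pos); rewrite !posK.
(* One family carries [B] at position [n] and the sides of the cylinder elsewhere, so independence
   applies both to the first [n] positions and to these together with position [n]; comparing the
   two products gives the claim. *)
pose C' j := if pos j == n then B else C (pos j).
have mC' j : measurable (C' j) by rewrite /C'; case: ifP.
have C'n : C' (e n) = B by rewrite /C' posK eqxx.
have C'lt i : (i < n)%N -> C' (e i) = C i.
  by move=> ilen; rewrite /C' posK ltn_eqF.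
have -> : [set w | forall i, (i < n)%N -> C i (obs i w)] =
    \big[setI/setT]_(j <- map e (iota 0 n)) (X j.1 j.2 @^-1` C' j).
  rewrite big_map -bigcap_seq; apply/seteqP; split=> w /= H i.
    by rewrite /= mem_iota add0n => /= ilen; rewrite C'lt//; exact: H.
  by move=> ilen; rewrite -C'lt//; apply: H; rewrite /= mem_iota.
have uniq_e s : uniq s -> uniq (map e s) by rewrite map_inj_uniq.
have := ind (map e (n :: iota 0 n)) C' (uniq_e (n :: iota 0 n) _) mC'.
rewrite [map e (n :: _)]/= !big_cons /= C'n setIC => ->; last first.
  by rewrite mem_iota add0n ltnn iota_uniq.
by rewrite -(ind _ C' (uniq_e _ (iota_uniq 0 n)) mC') muleC.
Qed.

Lemma measurable_data k n : measurable_fun setT (data X k n).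
Proof.
apply/measurable_fun_tnthP => i.
rewrite (_ : _ \o _ = X k i); first exact: mX.
by apply/funext => w; rewrite /= tnth_mktuple.
Qed.

(** The estimator for observation [m] uses the same stream at strictly earlier times, and those
    observations have positions below [m]. This gives predictability in the interleaved order. *)
Let measurable_data_history m :
  measurable_fun setT (data X (stream m) (time m) : history obs m -> _).
Proof.
apply/measurable_fun_tnthP => i.
rewrite (_ : _ \o _ = obs (pos (stream m, i : nat))).
  apply: measurable_history_obs.
  by rewrite -[ltnRHS]posK /pos/= ltn_add2r ltn_pmul2r.
by apply/funext => w; rewrite /= tnth_mktuple /obs streamK timeK.
Qed.

Lemma measurable_Lhat n : measurable_fun setT (Lhat f X thhat n).
Proof.
apply: measurable_prod => t _; apply: measurable_prod => k _.
have mp : measurable_fun setT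
    (fun w => (thhat k (data X k t w), X k t w)).
  apply/measurable_fun_pair => //.
  exact: (measurableT_comp (@mthhat k t) (@measurable_data k t)).
exact: (measurableT_comp mf mp).
Qed.

Lemma measurable_Lv n th : measurable_fun setT (Lv f X n th).
Proof.
apply: measurable_prod => k _; apply: measurable_prod => t _.
by have [_ [mfk _]] := df (th k); exact: (measurableT_comp mfk (@mX k t)).
Qed.

Lemma Lhat_ge0 n w : 0 <= Lhat f X thhat n w.
Proof.
apply: prodr_ge0 => t _; apply: prodr_ge0 => k _.
by have [f0 _] := df (thhat k (data X k t w)).
Qed.

Lemma Lv_ge0 n th w : 0 <= Lv f X n th w.
Proof.
apply: prodr_ge0 => k _; apply: prodr_ge0 => t _.
by have [f0 _] := df (th k).
Qed.

(** Each single factor vanishes with probability equal to the integral of [f (th k)] over its own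
    zero set, which is 0, and there are countably many factors. *)
Lemma Lv_eq0_null th : has_law nu f X P th ->
  P th [set w | exists n, Lv f X n th w = 0] = 0%E.
Proof.
move=> [_ law].
have mE k t : measurable (X k t @^-1` (f (th k) @^-1` [set 0])).
  rewrite -[X in measurable X]setTI; apply: mX => //.
  rewrite -[X in measurable X]setTI; have [_ [mfk _]] := df (th k).
  by apply: mfk.
apply: (@subset_measure0 _ _ _ (P th) _
  (\bigcup_m (obs m @^-1` (f (th (stream m)) @^-1` [set 0])))).
- rewrite (_ : [set w | _] = \bigcup_n Lv f X n th @^-1` [set 0]); last first.
    by apply/seteqP; split=> w /= [n]; [exists n|move=> _; exists n].
  apply: bigcupT_measurable => n.
  by rewrite -[X in measurable X]setTI; exact: measurable_Lv.
- by apply: bigcupT_measurable => m; exact: mE.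
- move=> w /= [n /eqP]; rewrite prodf_seq_eq0 => /hasP[k _ /=].
  rewrite prodf_seq_eq0 => /hasP[t _ /= /eqP fX].
  by exists (pos (k, t : nat)) => //=; rewrite /obs streamK timeK.
apply/negligibleP.
  by apply: bigcupT_measurable => m; exact: mE.
apply: negligible_bigcup => m; apply/negligibleP; first exact: mE.
apply: etrans (law (stream m) (time m) _ _) _.
  rewrite -[X in measurable X]setTI; have [_ [mfk _]] := df (th (stream m)).
  by apply: mfk.
by apply: integral0_eq => x /= ->.
Qed.

(** Ville's inequality for the interleaved ratio, which equals [Lhat / Lv] at the end of each full
    round, that is at indices [n * K]. Outcomes where [Lv] vanishes may satisfy the premise without
    a large ratio; they are covered by a null event. *)
Lemma adaptive_ville (th : 'I_K -> Th) (c : R) (E : set Om) :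
  has_law nu f X P th -> 0 < c -> measurable E ->
  (forall w, E w -> exists n, c * Lv f X n th w <= Lhat f X thhat n w) ->
  (P th E <= (c^-1)%:E)%E.
Proof.
move=> law c0 mE EL.
pose p m := f (th (stream m)).
pose q m w := f (thhat (stream m) (data X (stream m) (time m) w)).
have mpth m : measurable_fun setT (p m).
  by have [_ [mfm _]] := df (th (stream m)); exact: mfm.
have p0 m x : 0 <= p m x by have [f0 _] := df (th (stream m)); exact: f0.
have q0 m w x : 0 <= q m w x.
  have [f0 _] := df (thhat (stream m) (data X (stream m) (time m) w)).
  exact: f0.
have mq m : measurable_fun setT (fun z : history obs m * S => q m z.1 z.2).
  have mz : measurable_fun setT (fun z : history obs m * S =>
      (thhat (stream m) (data X (stream m) (time m) z.1), z.2)).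
    apply/measurable_fun_pair => //.
    apply: (measurableT_comp (@mthhat (stream m) (time m))).
    exact: (measurableT_comp (@measurable_data_history m) measurable_fst).
  exact: (measurableT_comp mf mz).
have q1 m w : (\int[nu]_x (q m w x)%:E <= 1)%E.
  rewrite /q.
  by have [_ [_ ->]] := df (thhat (stream m) (data X (stream m) (time m) w)).
have lawobs m B : measurable B ->
    P th (obs m @^-1` B) = (\int[nu]_(x in B) (p m x)%:E)%E.
  by move=> mB; exact: law.2.
have indobs m A B : cylinders obs m A -> measurable B ->
    P th (A `&` obs m @^-1` B) = (P th A * P th (obs m @^-1` B))%E.
  exact: indep_obs.
have LRE n w : likelihood_ratio obs p q (n * K) w =
    Lhat f X thhat n w / Lv f X n th w.
  rewrite /likelihood_ratio (prod_interleave (fun k t =>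
    f (thhat k (data X k t w)) (X k t w) / f (th k) (X k t w))).
  rewrite /Lv [X in _ / X]exchange_big -prodf_div; apply: eq_bigr => t _.
  by rewrite -prodf_div.
have mLR n : measurable_fun setT (likelihood_ratio obs p q n).
  apply: (measurable_history (@mobs) (n := n)).
  exact: measurable_likelihood_ratio.
have mhit : measurable [set w | exists n, c <= likelihood_ratio obs p q n w].
  rewrite (_ : [set w | _] =
      \bigcup_n (likelihood_ratio obs p q n @^-1` [set` `[c, +oo[])).
    apply: bigcupT_measurable => n; rewrite -[X in measurable X]setTI.
    by apply: mLR => //; exact: measurable_itv.
  apply/seteqP; split=> w /=.
    by move=> [n cn]; exists n => //=; rewrite in_itv/= cn.
  by move=> [n _]; rewrite /= in_itv/= andbT => cn; exists n.
have mnull : measurable [set w | exists n, Lv f X n th w = 0].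
  rewrite (_ : [set w | _] = \bigcup_n Lv f X n th @^-1` [set 0]); last first.
    by apply/seteqP; split=> w /= [n]; [exists n|move=> _; exists n].
  apply: bigcupT_measurable => n.
  by rewrite -[X in measurable X]setTI; exact: measurable_Lv.
apply: le_trans (likelihood_ratio_ville mobs indobs p0 mpth lawobs q0 mq q1 c0).
rewrite -[leRHS]adde0 -(Lv_eq0_null law).
apply: le_trans (measureU2 _ mhit mnull).
apply: le_measure; rewrite ?inE//; first exact: measurableU.
move=> w /EL[n cL]; have [Lv0|Lvn0] := eqVneq (Lv f X n th w) 0.
  by right; exists n.
left; exists (n * K)%N; rewrite LRE ler_pdivlMr// lt0r Lvn0.
exact: Lv_ge0.
Qed.

End streams.

(** * Errors and termination of the procedure *)

Section procedure.
Context (R : realType) (dS dT dO : measure_display)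
  (S : measurableType dS) (Th : measurableType dT) (Om : measurableType dO)
  (K : nat).
Variables (nu : {measure set S -> \bar R}) (f : Th -> S -> R) (Th1 : set Th).
Variables (X : 'I_K -> nat -> Om -> S) (P : ('I_K -> Th) -> probability Om R).
Variable thhat : 'I_K -> forall n : nat, n.-tuple S -> Th.
Hypothesis K0 : (0 < K)%N.
Hypothesis df : density_family nu f.
Hypothesis mf : measurable_fun setT (fun p : Th * S => f p.1 p.2).
Hypothesis mX : forall k t, measurable_fun setT (X k t).
Hypothesis mthhat : forall k n, measurable_fun setT (@thhat k n).
Hypothesis mstats : stats_measurable f Th1 X.
Variables (a b : R).
Hypotheses (a0 : 0 < a) (b0 : 0 < b).

Let exceeds (c : R) (i : bool) n : set Om :=
  [set w | (c%:E <= (Lhat f X thhat n w)%:E / Lbig f Th1 X i n w)%E].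

Lemma Lbig_ge0 i n w : (0 <= Lbig f Th1 X i n w)%E.
Proof. by apply: ereal_sup_ubound; right. Qed.

Let mLhat n : measurable_fun setT (fun w => (Lhat f X thhat n w)%:E).
Proof. by apply/measurable_EFinP; exact: measurable_Lhat. Qed.

Let mcLbig (c : R) i n :
  measurable_fun setT (fun w => (c%:E * Lbig f Th1 X i n w)%E).
Proof. by apply: measurable_funeM; have [_] := mstats n; exact. Qed.

Let measurable_Lhat_gt0 n : measurable [set w | 0 < Lhat f X thhat n w].
Proof.
have := measurable_lte measurableT (measurable_cst (0%E : \bar R)) (@mLhat n).
by rewrite setTI.
Qed.

Lemma exceedsE c i n w : 0 < c -> exceeds c i n w <->
  0 < Lhat f X thhat n w /\
  (c%:E * Lbig f Th1 X i n w <= (Lhat f X thhat n w)%:E)%E.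
Proof.
move=> c0; rewrite /exceeds /= le_ediv//; last 2 first.
- exact: Lhat_ge0 df _ _.
- exact: Lbig_ge0.
by split=> /andP.
Qed.

Let measurable_exceeds c i n : 0 < c -> measurable (exceeds c i n).
Proof.
move=> c0.
rewrite (_ : exceeds c i n = [set w | 0 < Lhat f X thhat n w] `&`
    [set w | (c%:E * Lbig f Th1 X i n w <= (Lhat f X thhat n w)%:E)%E]).
  apply: measurableI => //.
  have := measurable_lee measurableT (@mcLbig c i n) (@mLhat n).
  by rewrite setTI.
by apply/seteqP; split=> w /=; rewrite exceedsE.
Qed.

Let measurable_ratio_le c i n : 0 < c -> measurable
  [set w | ((Lhat f X thhat n w)%:E / Lbig f Th1 X i n w <= c%:E)%E].
Proof.
move=> c0.
rewrite (_ : [set w | _] = ~` ([set w | 0 < Lhat f X thhat n w] `&`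
    [set w | (c%:E * Lbig f Th1 X i n w < (Lhat f X thhat n w)%:E)%E])).
  apply/measurableC/measurableI => //.
  have := measurable_lte measurableT (@mcLbig c i n) (@mLhat n).
  by rewrite setTI.
apply/seteqP; split=> w /=.
  rewrite leNgt lt_ediv//; [|exact: Lhat_ge0 df _ _|exact: Lbig_ge0].
  by move=> /negP nH H; apply: nH; apply/andP.
move=> nH; rewrite leNgt lt_ediv//; [|exact: Lhat_ge0 df _ _|exact: Lbig_ge0].
by apply/negP => /andP.
Qed.

Let stops n : set Om := [set w | (0 < n)%N /\ stopcond f Th1 X thhat a b n w].

Let measurable_stops n : measurable (stops n).
Proof.
rewrite (_ : stops n = [set _ | (0 < n)%N] `&`
  (exceeds b false n `&` exceeds a true n)) //.
apply: measurableI; last by apply: measurableI; exact: measurable_exceeds.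
by case: (0 < n)%N; rewrite ?set_true ?set_false.
Qed.

Let first_stop n : That_eq f Th1 X thhat a b n =
  stops n `&` \bigcap_(m in [set m | (m < n)%N]) ~` stops m.
Proof.
apply/seteqP; split=> w /=.
  by move=> [n0 [st nst]]; split=> // m /= mn [m0]; exact: nst.
move=> [[n0 st] nst]; split=> //; split=> // m m0 mn stm.
exact: (nst m mn).
Qed.

Lemma measurable_That_eq n : measurable (That_eq f Th1 X thhat a b n).
Proof.
rewrite first_stop; apply: measurableI => //.
by apply: bigcap_measurableType => m _; exact: measurableC.
Qed.

Lemma That_exists :
  [set w | exists n, That_eq f Th1 X thhat a b n w] = \bigcup_n stops n.
Proof.
apply/seteqP; split=> w /=.
  by move=> [n]; rewrite first_stop => -[st _]; exists n.
move=> [n _ stn].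
have ex : exists n, `[< stops n w >] by exists n; exact/asboolP.
have [m /asboolP stm minm] := ex_minnP ex.
exists m; rewrite first_stop; split=> // i /= im /asboolP sti.
by have := minm _ sti; rewrite leqNgt im.
Qed.

Lemma error_bound (i : bool) (th : 'I_K -> Th) :
  has_law nu f X P th -> boldTheta Th1 th ->
  (P th [set w | exists n, That_eq f Th1 X thhat a b n w /\
     (if i then Ahat f Th1 X n w `\` Aset Th1 th
      else Aset Th1 th `\` Ahat f Th1 X n w) != set0]
   <= ((if i then a else b)^-1)%:E)%E.
Proof.
move=> law bth.
pose err n : set Om := [set w | (if i then Ahat f Th1 X n w `\` Aset Th1 th
  else Aset Th1 th `\` Ahat f Th1 X n w) != set0].
have mAhat n k : measurable [set w | Ahat f Th1 X n w k].
  have [mL _] := mstats n.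
  have := measurable_lee measurableT (mL false k) (mL true k).
  by rewrite setTI.
have merr n : measurable (err n).
  rewrite (_ : err n = \bigcup_(k in [set: 'I_K]) [set w |
      (if i then Ahat f Th1 X n w `\` Aset Th1 th
       else Aset Th1 th `\` Ahat f Th1 X n w) k]); last first.
    apply/seteqP; split=> w /=; first by move=> /set0P[k]; exists k.
    by move=> [k _ ?]; apply/set0P; exists k.
  (* For fixed [k], whether [th k] is a signal is deterministic, so the event is either empty or
     that of [k] being selected ([i = true]) or not selected ([i = false]). *)
  apply: fin_bigcup_measurable => // k _; case: (i).
  - have [Tk|nTk] := pselect (Th1 (th k)).
      rewrite (_ : [set w | _] = set0)//.
      by apply/seteqP; split=> w //= -[_]; exact.
    rewrite (_ : [set w | _] = [set w | Ahat f Th1 X n w k])//.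
    by apply/seteqP; split=> w //= -[].
  - have [Tk|nTk] := pselect (Th1 (th k)).
      rewrite (_ : [set w | _] = ~` [set w | Ahat f Th1 X n w k]).
        exact: measurableC.
      by apply/seteqP; split=> w //= -[].
    rewrite (_ : [set w | _] = set0)//.
    by apply/seteqP; split=> w //= -[].
apply: (adaptive_ville K0 df mf mX mthhat law); first by case: (i).
- rewrite (_ : [set w | _] = \bigcup_n (That_eq f Th1 X thhat a b n `&` err n)).
    apply: bigcupT_measurable => n; apply: measurableI => //.
    exact: measurable_That_eq.
  apply/seteqP; split=> w /=; first by move=> [n H]; exists n.
  by move=> [n _ H]; exists n.
move=> w [n [[n0 [[stb sta] _]] errn]]; exists n.
set c := if i then a else b.
have c0 : 0 < c by rewrite /c; case: (i).
have [_ cL] : 0 < Lhat f X thhat n w /\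
    (c%:E * Lbig f Th1 X i n w <= (Lhat f X thhat n w)%:E)%E.
  by apply/exceedsE => //; rewrite /c; case: (i).
rewrite -lee_fin EFinM; apply: le_trans cL.
rewrite lee_pmul2l// ?lte_fin//.
(* On the error event [th] itself is admissible in the supremum [Lbig], whose constraint is relative
   to the current [Ahat]. *)
by apply: ereal_sup_ubound; left; exists th.
Qed.

(** Never stopping implies, for every large [n], that one of the two ratios is below its threshold,
    hence in a low-rate event at [n]. The probability of never stopping is thus eventually bounded
    by the terms of a convergent series, so it is 0. *)
Lemma stops_almost_surely (th : 'I_K -> Th) :
  standing_assumption nu f Th1 -> condC nu f Th1 X P thhat ->
  boldTheta Th1 th ->
  P th [set w | exists n, That_eq f Th1 X thhat a b n w] = 1%E.
Proof.
move=> std cC bth; rewrite That_exists.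
have mstop : measurable (\bigcup_n stops n) by exact: bigcupT_measurable.
(* A rate strictly between 0 and the information number: half of it if finite, 1 if infinite. *)
have rate i : exists2 c : R, 0 < c & (c%:E < Ibold nu f Th1 i th)%E.
  have := Ibold_gt0 df std i bth.
  case: (Ibold nu f Th1 i th) => [r||//]; rewrite ?lte_fin => r0.
    exists (r / 2); first by rewrite divr_gt0.
    by rewrite lte_fin ltr_pdivrMr// ltr_pMr// ltr1n.
  by exists 1 => //; rewrite ltry.
have [c0 c00 cI0] := rate false.
have [c1 c10 cI1] := rate true.
pose low i (c : R) n := [set w | ((n%:R^-1)%:E *
  elog ((Lhat f X thhat n w)%:E / Lbig f Th1 X i n w) <= c%:E)%E].
have lowE i c n : (0 < n)%N -> low i c n =
    [set w | ((Lhat f X thhat n w)%:E / Lbig f Th1 X i n w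
       <= (expR (n%:R * c))%:E)%E].
  by move=> n0; apply/seteqP; split=> w; rewrite /low/= elog_le.
have mlow i c n : (0 < n)%N -> measurable (low i c n).
  by move=> n0; rewrite lowE//; apply: measurable_ratio_le; exact: expR_gt0.
(* A ratio below [r] is at most [expR (n * c)], because
   [r <= n * c <= 1 + n * c <= expR (n * c)]. *)
have not_exceeds (r c : R) i n w : 0 < c -> (0 < n)%N -> r <= n%:R * c ->
    ~ exceeds r i n w -> low i c n w.
  move=> c_gt0 n0 rn /negP; rewrite -ltNge => ratio_lt; rewrite lowE//=.
  apply: (le_trans (ltW ratio_lt)); rewrite lee_fin.
  by apply: (le_trans rn); apply: le_trans (expR_ge1Dx _); rewrite lerDr.
have large (r c : R) : 0 < c ->
    exists N, forall n, (N <= n)%N -> r <= n%:R * c.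
  move=> c_gt0; exists (Num.truncn (r / c)).+1 => n Nn.
  rewrite -ler_pdivrMr//; apply: ltW; apply: lt_le_trans (truncnS_gt _) _.
  by rewrite ler_nat.
have [N0 N0P] := large b c0 c00.
have [N1 N1P] := large a c1 c10.
pose u n := (P th (low false c0 n) + P th (low true c1 n))%E.
have fin_stop : P th (~` \bigcup_n stops n) \is a fin_num.
  by apply: fin_num_measure; exact: measurableC.
have uP n : (maxn 1 (maxn N0 N1) <= n)%N ->
    ((fine (P th (~` \bigcup_n stops n)))%:E <= u n)%E.
  rewrite !geq_max => /and3P[n0 N0n N1n]; rewrite fineK//.
  apply: le_trans (measureU2 _ (mlow _ _ _ n0) (mlow _ _ _ n0)).
  apply: le_measure; rewrite ?inE.
  - exact: measurableC.
  - by apply: measurableU; exact: mlow.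
  move=> w nst; have [exb|nexb] := pselect (exceeds b false n w); last first.
    by left; apply: not_exceeds nexb => //; exact: N0P.
  right; apply: (not_exceeds a) => //; first exact: N1P.
  by move=> exa; apply: nst; exists n.
have usum : (\sum_(1 <= n <oo) u n < +oo)%E.
  rewrite nneseriesD; [|by move=> *; exact: measure_ge0..].
  by apply: lte_add_pinfty; exact: cC.
have := eventually_lbound_nneseries _ uP usum.
rewrite -lee_fin fineK// => /(_ _)/wrap[n|nst0].
  by rewrite adde_ge0.
rewrite -[X in P th X = _]setCK probability_setC; last exact: measurableC.
have -> : P th (~` \bigcup_n stops n) = 0%E.
  by apply/eqP; rewrite eq_le nst0 measure_ge0.
by rewrite sube0.
Qed.

End procedure.
Theorem theorem2 (R : realType) (dS dT dO : measure_display)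
  (S : measurableType dS) (Th : measurableType dT) (Om : measurableType dO)
  (K : nat) (nu : {measure set S -> \bar R}) (f : Th -> S -> R)
  (Th1 : set Th) (X : 'I_K -> nat -> Om -> S)
  (P : ('I_K -> Th) -> probability Om R)
  (thhat : 'I_K -> forall n : nat, n.-tuple S -> Th) :
  (0 < K)%N ->
  sigma_finite setT nu ->
  Th1 !=set0 -> (~` Th1) !=set0 ->
  density_family nu f ->
  measurable_fun setT (fun p : Th * S => f p.1 p.2) ->
  standing_assumption nu f Th1 ->
  (forall k t, measurable_fun setT (X k t)) ->
  (forall th, has_law nu f X P th) ->
  (forall k n, measurable_fun setT (thhat k n)) ->
  nearMLE f X thhat ->
  stats_measurable f Th1 X ->
  condC nu f Th1 X P thhat ->
  forall th, boldTheta Th1 th -> forall a b : R, 0 < a -> 0 < b ->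
    P th [set w | exists n, That_eq f Th1 X thhat a b n w] = 1%E /\
    (P th [set w | exists n, That_eq f Th1 X thhat a b n w /\
                     Ahat f Th1 X n w `\` Aset Th1 th != set0]
       <= (a^-1)%:E)%E /\
    (P th [set w | exists n, That_eq f Th1 X thhat a b n w /\
                     Aset Th1 th `\` Ahat f Th1 X n w != set0]
       <= (b^-1)%:E)%E.
Proof.
move=> K0 _ _ _ df mf std mX law mthhat _ mstats cC th bth a b a0 b0.
split.
  exact: (stops_almost_surely df mf mX mthhat mstats a0 b0 std cC bth).
split.
- exact: (error_bound K0 df mf mX mthhat mstats a0 b0 true (law th) bth).
- exact: (error_bound K0 df mf mX mthhat mstats a0 b0 false (law th) bth).
Qed.
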